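(* Let $p\geq 1$ be a fixed integer. For $q\geq 1$ let $\lambda_1(q)\geq\lambda_2(q)$ be the largest and second largest eigenvalues of the adjacency matrix of the rotation graph $\mathcal{R}(K_{p,q})$ of the complete bipartite graph $K_{p,q}$. Then $\lambda_1(q)-\lambda_2(q)\to 0$ as $q\to\infty$.
   Context: Graphs are finite, simple and undirected. A search tree $T$ on a connected graph $G$ is a rooted tree with vertex set $V(G)$, defined recursively: the root of $T$ is a chosen vertex $r\in V(G)$, and the children of $r$ are the roots of search trees on each of the connected components of $G-r$. Let $T$ be a search tree on $G$ and let $v$ be a child of $u$ in $T$. The $uv$-rotation transforms $T$ into the search tree $T'$ on $G$ such that: (i) $u$ is a child of $v$ in $T'$; if $u$ is the root of $T$ then $v$ is the root of $T'$, otherwise, if $p$ is the parent of $u$ in $T$, then $p$ is the parent of $v$ in $T'$; (ii) every subtree of $u$ in $T$ other than the one rooted at $v$ remains a subtree of $u$ in $T'$; (iii) each subtree $S$ of $v$ in $T$ becomes a subtree of $u$ in $T'$ if $u$ is adjacent in $G$ to some vertex of $S$, and otherwise remains a subtree of $v$. All other parent-child relations are unchanged. The rotation graph $\mathcal{R}(G)$ is the undirected graph whose vertices are the search trees on $G$, two search trees being adjacent if one is obtained from the other by a single rotation. It is $(|V(G)|-1)$-regular. Eigenvalues are listed with multiplicity. *)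

(* Defs.v *)
From HB Require Import structures.
From mathcomp Require Import all_boot all_order all_algebra.
From mathcomp Require Import polyrcf.
From mathcomp Require Import boolp reals.

Set Implicit Arguments.
Unset Strict Implicit.
Unset Printing Implicit Defensive.

Import Order.TTheory GRing.Theory Num.Theory.
Local Open Scope ring_scope.

Record sgraph := SGraph {
  vertex :> finType;
  edge : rel vertex;
  edge_sym : symmetric edge;
  edge_irr : irreflexive edge
}.

Definition Kedge (p q : nat) : rel ('I_p + 'I_q)%type := fun x y =>
  match x, y with
  | inl _, inr _ | inr _, inl _ => true
  | _, _ => false
  end.

Lemma Kedge_sym p q : symmetric (@Kedge p q).
Proof. by case=> x [] y. Qed.

Lemma Kedge_irr p q : irreflexive (@Kedge p q).
Proof. by case. Qed.

Definition complete_bipartite (p q : nat) : sgraph := SGraph (@Kedge_sym p q) (@Kedge_irr p q).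

Section SearchTrees.
Variable G : sgraph.
Implicit Types (C D : {set G}) (T : {ffun G -> option G}) (r u v w x : G).

Definition induced C : rel G := fun x y => [&& x \in C, y \in C & edge x y].

(* Vertex sets of the connected components of the subgraph induced by C. *)
Definition components C : {set {set G}} :=
  equivalence_partition (connect (induced C)) C.

(* A rooted tree is given by its parent function T; the root is sent to None.
   [search_tree_on T C o] says that T restricted to C is a search tree on the
   subgraph induced by C, whose root has parent o in the ambient tree; every recursive call is on a
   connected C, so only a top-level graph G has to be connected. *)
Inductive search_tree_on T : {set G} -> option G -> Prop :=
  SearchTreeOn C o r of
    r \in C & T r = o &
    (forall D, D \in components (C :\ r) -> search_tree_on T D (Some r)) :
    search_tree_on T C o.

Record searchTree := SearchTree {
  parent :> {ffun G -> option G};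
  _ : `[< search_tree_on parent [set: G] None >]
}.

HB.instance Definition _ := [isSub for parent].
HB.instance Definition _ := [Finite of searchTree by <:].

(* Vertex set of the subtree of T rooted at w: the descendants of w. *)
Definition subtree T w : {set G} :=
  [set x | connect (fun a b => T a == Some b) x w].

(* The uv-rotation; meaningful when v is a child of u. *)
Definition rotate T u v : {ffun G -> option G} :=
  [ffun w =>
    if w == v then T u
    else if w == u then Some v
    else if T w == Some v then
      if [exists x in subtree T w, edge u x] then Some u else Some v
    else T w].

Definition rotates_to (T T' : searchTree) : bool :=
  [exists u, exists v, (T v == Some u) && (parent T' == rotate T u v)].

Definition rotation_edge : rel searchTree := fun T T' : searchTree =>
  rotates_to T T' || rotates_to T' T.

Lemma rotation_edge_sym : symmetric rotation_edge.
Proof. by move=> T1 T2; rewrite /rotation_edge orbC. Qed.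

Lemma mem_component C D x : D \in components C -> x \in D -> x \in C.
Proof. by case/imsetP=> y _ ->; rewrite inE => /andP[]. Qed.

Lemma component_cover C x :
  x \in C -> exists2 D, D \in components C & x \in D.
Proof.
move=> xC; exists [set y in C | connect (induced C) x y].
  by apply/imsetP; exists x.
by rewrite inE xC connect0.
Qed.

Lemma search_tree_on_parent T C o u : search_tree_on T C o -> u \in C ->
  T u = o \/ exists2 w, w \in C & T u = Some w.
Proof.
move=> H; elim: H u => {}C {}o r rC Tr _ IH u uC.
have [->|neq] := eqVneq u r; first by left.
have /component_cover[D DC uD] : u \in C :\ r by rewrite !inE neq.
right; case: (IH D DC u uD) => [->|[w wD ->]]; first by exists r.
by exists w => //; move: (mem_component DC wD); rewrite inE => /andP[].
Qed.

Lemma search_tree_on_acyclic2 T C o u v :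
  search_tree_on T C o -> (forall w, o = Some w -> w \notin C) ->
  u \in C -> v \in C -> T u = Some v -> T v = Some u -> False.
Proof.
move=> H; elim: H u v => {}C {}o r rC Tr sub IH u v oC uC vC Tu Tv.
have [ur|ur] := eqVneq u r.
  by move: (oC v); rewrite -Tr -ur Tu vC => /(_ erefl).
have [vr|vr] := eqVneq v r.
  by move: (oC u); rewrite -Tr -vr Tv uC => /(_ erefl).
have /component_cover[D DC uD] : u \in C :\ r by rewrite !inE ur.
have vD : v \in D.
  case: (search_tree_on_parent (sub D DC) uD); rewrite Tu.
    by case=> vr'; rewrite vr' eqxx in vr.
  by case=> w wD [->].
apply: (IH D DC u v _ uD vD Tu Tv) => w [<-].
by apply/negP => /(mem_component DC); rewrite !inE eqxx.
Qed.

Lemma rotates_to_irr : irreflexive rotates_to.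
Proof.
move=> T; apply/negbTE/negP => /fintype.existsP[u] /fintype.existsP[v] /andP[/eqP Tv /eqP E].
case: T Tv E => T /= hT Tv E; move/asboolP: (hT) => st.
have nof : forall w, None = Some w -> w \notin [set: G] by [].
have := search_tree_on_acyclic2 st nof (in_setT u) (in_setT v).
apply=> //; rewrite E ffunE eqxx; case: eqP => // uv.
by subst v; case: (search_tree_on_acyclic2 st nof (in_setT u) (in_setT u) Tv Tv).
Qed.

Lemma rotation_edge_irr : irreflexive rotation_edge.
Proof. by move=> T; rewrite /rotation_edge rotates_to_irr. Qed.

Definition rotation_graph : sgraph :=
  SGraph rotation_edge_sym rotation_edge_irr.

End SearchTrees.

Section Spectrum.
Variable R : realType.

Definition adjacency_mx (G : sgraph) : 'M[R]_#|G| :=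
  \matrix_(i, j) (edge (enum_val i) (enum_val j))%:R.

(* Real eigenvalues with (algebraic) multiplicity, in nonincreasing order;
   for a symmetric matrix of order n this list has length n. *)
Definition eigenvalues (n : nat) (A : 'M[R]_n) : seq R :=
  sort >=%R
    (flatten [seq nseq (mup x (char_poly A)) x | x <- rootsR (char_poly A)]).

Definition lambda1 (G : sgraph) : R := (eigenvalues (adjacency_mx G))`_0.
Definition lambda2 (G : sgraph) : R := (eigenvalues (adjacency_mx G))`_1.

End Spectrum.

(* Main.v *)
Require Import Defs.
From mathcomp Require Import all_boot all_order all_algebra.
From mathcomp Require Import perm polyrcf complex.
From mathcomp Require Import ring lra zify.
From mathcomp Require Import boolp reals.
Import Order.TTheory GRing.Theory Num.Theory.
Local Open Scope ring_scope.

Set Implicit Arguments.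
Unset Strict Implicit.
Unset Printing Implicit Defensive.

(** Let Q be the side of size q of K = K_{p,q}. The rotation graph of K is
    regular of degree d = p+q-1, so its largest eigenvalue is at most d, and
    the constant function is an eigenvector for d. By the min-max principle
    (spectral_gap_le, regular_spectral_gap), it is enough to find a function f
    of mean zero on search trees whose Dirichlet energy, the sum of
    (f T - f T')^2 over the rotations between T and T', is small compared
    with the sum of the f(T)^2.

    Fix two vertices x and y in Q, and let f(T) be 1 if x is an ancestor of y
    in T, -1 if y is an ancestor of x, and 0 otherwise.

    - The automorphism of K exchanging x and y gives f mean zero.
    - f is nonzero on at least two thirds of the trees (card_incomparable). If x
      and y are incomparable in T, they are children of the same vertex z, and
      the rotation that lifts x above z is an injection of these trees into
      those where x is an ancestor of y.
    - A rotation can only destroy the relation that x is an ancestor of y if x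
      is the parent or the grandparent of y (rotate_lost), and at most one
      rotation of T does so (card_lost). As y has one parent and one
      grandparent, and as all candidates x in Q are equivalent under the
      automorphisms of K fixing y, this happens in at most a fraction 2/(q-1)
      of the trees (card_shortly_above).

    So the energy is at most O(1/q) times the sum of the f(T)^2, and the gap is
    at most 24/(q-1) (bipartite_gap).

    Degrees and rotations are handled through a local criterion for a parent
    function to be a search tree, is_tree, that avoids the recursion on
    components; it is preserved by rotations (rotate_is_tree), and the
    vu-rotation undoes the uv-rotation (rotateK). *)

(** * Eigenvalues of real symmetric matrices *)

Section RealSymmetric.
Variable R : realType.
Local Notation C := (complex R).
Local Notation toC := (real_complex R).
Local Open Scope sesquilinear_scope.

(** The unitary change of basis lives over R[i], where Hermitian matrices are
    diagonalizable; the diagonal is real. *)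
Lemma sym_spectral n (A : 'M[R]_n) : A^T = A ->
  exists D : 'rV[R]_n, exists2 P : 'M[C]_n,
    P \is unitarymx & map_mx toC A = P^t* *m diag_mx (map_mx toC D) *m P.
Proof.
move=> symA; have Aherm : map_mx toC A \is hermsymmx.
  apply: realsym_hermsym.
    apply/is_hermitianmxP; rewrite expr0 scale1r map_mx_id //.
    by rewrite map_trmx symA.
  by apply/mxOverP => i j; rewrite mxE; apply/complex_realP; exists (A i j).
have /hermitian_normalmx/orthomx_spectralP AE := Aherm.
have /mxOverP Dreal := hermitian_spectral_diag_real Aherm.
exists (map_mx (@complex.Re R) (spectral_diag (map_mx toC A))).
exists (spectralmx (map_mx toC A)); first exact: spectral_unitarymx.
rewrite [LHS]AE invmx_unitary ?spectral_unitarymx //.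
congr (_ *m diag_mx _ *m _); apply/matrixP => i j; rewrite !mxE.
by rewrite RRe_real.
Qed.

Lemma char_poly_spectral n (A : 'M[R]_n) (D : 'rV[R]_n) (P : 'M[C]_n) :
  P \is unitarymx -> map_mx toC A = P^t* *m diag_mx (map_mx toC D) *m P ->
  char_poly A = \prod_(i < n) ('X - (D 0 i)%:P).
Proof.
move=> Pu AE; apply: (@map_poly_inj _ _ toC).
rewrite map_char_poly AE -invmx_unitary //.
have Punit := unitarymx_unit Pu.
have -> : char_poly (invmx P *m diag_mx (map_mx toC D) *m P)
          = char_poly (diag_mx (map_mx toC D)).
  rewrite /char_poly /char_poly_mx !map_mxM.
  have PP : map_mx polyC (invmx P) *m map_mx polyC P = 1%:M.
    by rewrite -map_mxM mulVmx // map_mx1.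
  have -> : 'X%:M - map_mx polyC (invmx P) *m map_mx polyC (diag_mx (map_mx toC D))
         *m map_mx polyC P = map_mx polyC (invmx P) *m
    ('X%:M - map_mx polyC (diag_mx (map_mx toC D))) *m map_mx polyC P.
    by rewrite mulmxBr mulmxBl scalar_mxC -['X%:M *m _ *m _]mulmxA PP mulmx1.
  by rewrite !det_mulmx mulrC mulrA [\det (map_mx _ P) * _]mulrC -det_mulmx PP det1 mul1r.
rewrite char_poly_trig ?diag_mx_is_trig // rmorph_prod.
by apply: eq_bigr => i _; rewrite rmorphB /= map_polyX map_polyC /= !mxE eqxx mulr1n.
Qed.

Lemma mup_prod_XsubC (F : fieldType) (I : Type) (r : seq I) (f : I -> F) x :
  mup x (\prod_(i <- r) ('X - (f i)%:P)) = count (fun i => f i == x) r.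
Proof.
elim: r => [|i r IH]; first by rewrite big_nil mupNroot // root1.
rewrite big_cons mupM ?polyXsubC_eq0 // ?IH /=.
  by rewrite -[X in mup x X]expr1 mup_XsubCX eq_sym; case: eqP.
by rewrite monic_neq0 // monic_prod_XsubC.
Qed.

(** A product of linear factors has no other roots, so that no eigenvalue is
    missed by listing the real roots of the characteristic polynomial. *)
Lemma perm_eigenvalues n (A : 'M[R]_n) (D : 'rV[R]_n) :
  char_poly A = \prod_(i < n) ('X - (D 0 i)%:P) ->
  perm_eq (eigenvalues A) [seq D 0 i | i <- enum 'I_n].
Proof.
move=> cE; rewrite /eigenvalues perm_sort; apply/allP => x _ /=; apply/eqP.
rewrite [RHS]count_map -[RHS](mup_prod_XsubC (enum 'I_n) (D 0)) big_enum -cE.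
have p0 : char_poly A != 0 by rewrite monic_neq0 // char_poly_monic.
rewrite count_flatten -map_comp sumnE big_map.
rewrite (eq_bigr (fun y => if y == x then mup x (char_poly A) else 0)%N); last first.
  by move=> y _ /=; rewrite count_nseq /=; case: eqP => [->|_]; rewrite ?mul1n ?mul0n.
rewrite -big_mkcond /= big_const_seq iter_addn_0.
rewrite -[count _ _]/(count_mem x _) count_uniq_mem ?uniq_roots //.
rewrite -(roots_on_rootsR p0 x) in_itv /=.
by case: (boolP (root _ x)) => [_|/mupNroot ->]; rewrite ?muln1.
Qed.

Lemma sorted_second (s : seq R) (c : R) : sorted >=%R s ->
  (1 < count (>= c)%R s)%N -> c <= s`_1.
Proof.
case: s => [|a [|b s]] //=; first by case: (c <= a).
move=> /andP[_ srt] cnt; rewrite leNgt; apply/negP => bc.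
suff : (count (>= c)%R (b :: s) = 0)%N.
  by move=> E; move: cnt; rewrite -[(_ + (_ + _))%N]/(_ + count _ (b :: s))%N E; case: (c <= a).
apply/eqP; rewrite -leqn0 leqNgt -has_count; apply/hasPn => x.
rewrite inE -ltNge => /orP[/eqP->//|xs].
by apply: le_lt_trans bc; have /allP/(_ x xs) := order_path_min ge_trans srt.
Qed.


Definition mxform n (A : 'M[R]_n) (u v : 'rV[R]_n) : R := (u *m A *m v^T) 0 0.

(** Evaluate the form at an eigenvector. *)
Lemma eigenvalues_le n (A : 'M[R]_n) d x :
  (forall w, mxform A w w <= d * mxform 1%:M w w) -> x \in eigenvalues A -> x <= d.
Proof.
move=> Hd; rewrite mem_sort => /flattenP[s /mapP[y + ->]].
rewrite mem_nseq => + /andP[_ /eqP ->].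
have p0 : char_poly A != 0 by rewrite monic_neq0 // char_poly_monic.
rewrite -(roots_on_rootsR p0 y) => /andP[_].
rewrite -eigenvalue_root_char => /eigenvalueP[w wA w0].
move: (Hd w); rewrite /mxform wA mulmx1 -scalemxAl mxE ler_pM2r //.
rewrite mxE lt_def; apply/andP; split; last first.
  by apply: sumr_ge0 => i _; rewrite mxE -expr2 sqr_ge0.
apply: contra w0 => /eqP; move/psumr_eq0P => w0.
apply/eqP/rowP => i; rewrite mxE; apply/eqP; rewrite -sqrf_eq0 expr2.
have := w0 _ i isT; rewrite mxE => -> // j _.
by rewrite mxE -expr2 sqr_ge0.
Qed.

(** The lower half of the min-max principle for a plane. If at most one
    eigenvalue, of index i0, were at least c, then some nonzero complex
    combination h of u and v would have no component along the eigenvector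
    i0, and the form A - c would be negative at h. But u and v are orthogonal
    for A and for the scalar product, so A - c is nonnegative on their span. *)
Lemma two_diagonal_entries_ge n (A : 'M[R]_n) (D : 'rV[R]_n) (P : 'M[C]_n) c u v :
  P \is unitarymx -> map_mx toC A = P^t* *m diag_mx (map_mx toC D) *m P ->
  0 < mxform 1%:M u u -> 0 < mxform 1%:M v v ->
  mxform 1%:M u v = 0 -> mxform 1%:M v u = 0 -> mxform A u v = 0 -> mxform A v u = 0 ->
  c * mxform 1%:M u u <= mxform A u u -> c * mxform 1%:M v v <= mxform A v v ->
  exists i j, [/\ i != j, c <= D 0 i & c <= D 0 j].
Proof.
move=> Pu AE u0 v0 uv vu uAv vAu cu cv.
have [[i0 Hi0]|] := pselect (exists i0, forall i, i != i0 -> D 0 i < c); last first.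
  move=> none; case: n => [|n] in A D P u v Pu AE u0 v0 uv vu uAv vAu cu cv none *.
    by move: u0; rewrite /mxform mxE big_ord0 ltxx.
  have [i ci] : exists i, c <= D 0 i.
    by apply: contrapT => H; apply: none; exists 0 => i _; rewrite ltNge; apply/negP => ?; apply: H; exists i.
  have [j ji cj] : exists2 j, j != i & c <= D 0 j.
    apply: contrapT => H; apply: none; exists i => j ji.
    by rewrite ltNge; apply/negP => ?; apply: H; exists j.
  by exists i, j; rewrite eq_sym.
exfalso.
pose U := map_mx toC u; pose V := map_mx toC v.
pose y (h : 'rV[C]_n) := h *m P^t*.
have [ab ab0 yab] : exists2 ab : C * C, (ab.1 != 0) || (ab.2 != 0) &
    y (ab.1 *: U + ab.2 *: V) 0 i0 = 0.
  have [/andP[_ /eqP z]|nz] := boolP ((y V 0 i0 == 0) && (y U 0 i0 == 0)).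
    by exists (1, 0); rewrite /= ?oner_neq0 // scale1r scale0r addr0.
  exists (y V 0 i0, - y U 0 i0); first by rewrite oppr_eq0 -negb_and.
  by rewrite /= /y mulmxDl -!scalemxAl !mxE mulrC mulNr subrr.
case: ab => a b /= in ab0 yab; set h := a *: U + b *: V in yab.
(* The cross terms vanish, u and v being orthogonal for B. *)
have mxformE (B : 'M[R]_n) : mxform B u v = 0 -> mxform B v u = 0 ->
    (h *m map_mx toC B *m h^t*) 0 0 =
    `|a| ^+ 2 * (mxform B u u)%:C%C + `|b| ^+ 2 * (mxform B v v)%:C%C.
  move=> Buv Bvu.
  have toF w w' : map_mx toC w *m map_mx toC B *m (map_mx toC w')^t* = (mxform B w w')%:C%C%:M.
    have -> : (map_mx toC w')^t* = map_mx toC w'^T.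
      by apply/matrixP => i j; rewrite !mxE conj_Creal //; apply/complex_realP; eexists.
    by rewrite -!map_mxM [LHS]mx11_scalar mxE.
  rewrite /h linearD map_mxD !linearZ !map_mxZ /= !mulmxDl !mulmxDr.
  rewrite -!scalemxAl -!scalemxAr !toF Buv Bvu !mxE eqxx !mulr1n.
  by rewrite !mulr0 add0r addr0 !mulrA !normCK.
have yE B : h *m (P^t* *m B *m P) *m h^t* = y h *m B *m (y h)^t*.
  by rewrite /y trmx_mul map_mxM /= trmxCK !mulmxA.
have sumE (B : 'rV[C]_n) : (y h *m diag_mx B *m (y h)^t*) 0 0 =
    \sum_i B 0 i * `|y h 0 i| ^+ 2.
  rewrite mxE; apply: eq_bigr => i _; rewrite mul_mx_diag !mxE normCK.
  by rewrite mulrAC mulrC.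
pose N := \sum_i (D 0 i - c)%:C%C * `|y h 0 i| ^+ 2.
have NE : N = `|a| ^+ 2 * (mxform A u u - c * mxform 1%:M u u)%:C%C +
              `|b| ^+ 2 * (mxform A v v - c * mxform 1%:M v v)%:C%C.
  have H1 := mxformE A uAv vAu; have H2 := mxformE _ uv vu.
  rewrite AE yE sumE in H1.
  have I1 : map_mx toC (1%:M : 'M_n) = P^t* *m diag_mx (const_mx 1) *m P.
    by rewrite diag_const_mx mulmx1 map_mx1 -invmx_unitary // mulVmx // unitarymx_unit.
  rewrite I1 yE sumE in H2.
  transitivity (\sum_i (map_mx toC D) 0 i * `|y h 0 i| ^+ 2 - c%:C%C *
    \sum_i (const_mx 1 : 'rV[C]_n) 0 i * `|y h 0 i| ^+ 2).
    rewrite mulr_sumr -sumrB; apply: eq_bigr => i _.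
    by rewrite !mxE mul1r rmorphB mulrBl.
  rewrite H1 H2 !rmorphB !rmorphM /=; ring.
have Nge : 0 <= N.
  by rewrite NE addr_ge0 // mulr_ge0 ?exprn_ge0 ?normr_ge0 // ler0c subr_ge0.
have yh0 : y h = 0.
  have Hle i : 0 <= (c - D 0 i)%:C%C * `|y h 0 i| ^+ 2.
    have [->|/Hi0 lt] := eqVneq i i0; first by rewrite yab normr0 expr0n mulr0.
    by rewrite mulr_ge0 ?exprn_ge0 // ler0c subr_ge0 ltW.
  have S0 : \sum_i (c - D 0 i)%:C%C * `|y h 0 i| ^+ 2 = 0.
    apply/le_anti; rewrite sumr_ge0 // andbT.
    rewrite -oppr_ge0 -sumrN; rewrite [leRHS](_ : _ = N) //.
    by apply: eq_bigr => i _; rewrite -mulNr -rmorphN opprB.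
  apply/rowP => i; rewrite [RHS]mxE.
  have [->//|/Hi0 lt] := eqVneq i i0.
  have /eqP := psumr_eq0P (fun i _ => Hle i) S0 (i := i) isT.
  rewrite mulf_eq0 sqrf_eq0 normr_eq0 => /orP[|/eqP//].
  by rewrite -(rmorph0 toC) (inj_eq (@complexI R)) subr_eq0 gt_eqF.
have := mxformE _ uv vu; rewrite map_mx1 mulmx1.
have -> : h = 0 by rewrite -(mulmxKtV h Pu erefl) -/(y h) yh0 mul0mx.
rewrite mul0mx mxE => /esym/eqP.
have pos (z : C) (r : R) : 0 < r -> 0 <= `|z| ^+ 2 * r%:C%C.
  by move=> r0; rewrite mulr_ge0 ?exprn_ge0 // ler0c ltW.
have zero (z : C) (r : R) : 0 < r -> (`|z| ^+ 2 * r%:C%C == 0) = (z == 0).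
  move=> r0; rewrite mulf_eq0 sqrf_eq0 normr_eq0 orbC.
  by rewrite -{1}(rmorph0 toC) (inj_eq (@complexI R)) gt_eqF.
rewrite paddr_eq0 ?pos ?zero // => /andP[/eqP a0 /eqP b0].
by move: ab0; rewrite a0 b0 eqxx.
Qed.

Lemma spectral_gap_le n (A : 'M[R]_n) c d u v : A^T = A ->
  (forall w, mxform A w w <= d * mxform 1%:M w w) ->
  0 < mxform 1%:M u u -> 0 < mxform 1%:M v v ->
  mxform 1%:M u v = 0 -> mxform 1%:M v u = 0 -> mxform A u v = 0 -> mxform A v u = 0 ->
  c * mxform 1%:M u u <= mxform A u u -> c * mxform 1%:M v v <= mxform A v v ->
  0 <= (eigenvalues A)`_0 - (eigenvalues A)`_1 <= d - c.
Proof.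
move=> symA Ad u0 v0 uv vu uAv vAu cu cv.
have [D [P Pu AE]] := sym_spectral symA.
have [i [j [ij ci cj]]] :=
  two_diagonal_entries_ge Pu AE u0 v0 uv vu uAv vAu cu cv.
have permD := perm_eigenvalues (char_poly_spectral Pu AE).
have cnt : (1 < count (>= c)%R (eigenvalues A))%N.
  rewrite (seq.permP permD) count_map -size_filter.
  apply: (@leq_trans (size [:: i; j])) => //; apply: uniq_leq_size.
    by rewrite /= inE ij.
  by move=> k; rewrite mem_filter mem_enum andbT !inE => /orP[]/eqP->.
have srt : sorted >=%R (eigenvalues A) by apply: sort_sorted; apply: ge_total.
have := sorted_second srt cnt.
have sz : (1 < size (eigenvalues A))%N := leq_trans cnt (count_size _ _).
have e0d : (eigenvalues A)`_0 <= d.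
  by apply: eigenvalues_le Ad _; rewrite mem_nth // ltnW.
case: (eigenvalues A) srt sz e0d => [|a [|b s]] //= /andP[ba _] _ ad cb.
by rewrite subr_ge0 ba lerB.
Qed.
End RealSymmetric.

(** * Test functions on regular graphs *)

Section RegularGraphs.
Variables (R : realType) (G : sgraph).
Local Notation A := (adjacency_mx R G).

Definition rowf (f : G -> R) : 'rV[R]_#|G| := \row_i f (enum_val i).

Lemma rowfK (w : 'rV[R]_#|G|) : w = rowf (fun x => w 0 (enum_rank x)).
Proof. by apply/rowP => i; rewrite mxE enum_valK. Qed.

Lemma tr_adjacency_mx : A^T = A.
Proof. by apply/matrixP => i j; rewrite !mxE edge_sym. Qed.

Lemma form1E f g : mxform 1%:M (rowf f) (rowf g) = \sum_x f x * g x.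
Proof.
rewrite /mxform mulmx1 mxE (reindex (@enum_val G G)); last exact/onW_bij/enum_val_bij.
by apply: eq_bigr => i _; rewrite !mxE.
Qed.

Lemma form_adjE f g :
  mxform A (rowf f) (rowf g) = \sum_x \sum_y (edge x y)%:R * (f x * g y).
Proof.
rewrite /mxform -mulmxA mxE (reindex (@enum_val G G)); last exact/onW_bij/enum_val_bij.
apply: eq_bigr => i _; rewrite !mxE mulr_sumr [RHS](reindex (@enum_val G G)); last first.
  exact/onW_bij/enum_val_bij.
by apply: eq_bigr => j _; rewrite !mxE mulrCA.
Qed.

Lemma sum_edge (x : G) : \sum_y (edge x y)%:R = #|[set y | edge x y]|%:R :> R.
Proof.
rewrite -sum1dep_card natr_sum [RHS]big_mkcond.
by apply: eq_bigr => y _; case: edge.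
Qed.

(** Expand the square; by regularity each of the two square terms contributes
    d times the squared norm. *)
Lemma regular_form d f : (forall x : G, #|[set y | edge x y]| = d) ->
  \sum_x \sum_y (edge x y)%:R * (f x - f y) ^+ 2 =
  (d%:R * mxform 1%:M (rowf f) (rowf f) - mxform A (rowf f) (rowf f)) *+ 2.
Proof.
move=> reg.
have deg (x : G) : \sum_y (edge x y)%:R = d%:R :> R by rewrite sum_edge (reg x).
have S1 : \sum_x \sum_y (edge x y)%:R * (f x * f x) = d%:R * \sum_x f x * f x.
  by rewrite mulr_sumr; apply: eq_bigr => x _; rewrite -mulr_suml deg.
have S2 : \sum_x \sum_y (edge x y)%:R * (f y * f y) = d%:R * \sum_x f x * f x.
  rewrite exchange_big -S1; apply: eq_bigr => x _; apply: eq_bigr => y _.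
  by rewrite edge_sym.
rewrite form1E form_adjE mulrnBl mulr2n -{1}S1 -S2 -big_split /= -sumrMnl -sumrB.
apply: eq_bigr => x _; rewrite -big_split /= -sumrMnl -sumrB.
by apply: eq_bigr => y _; ring.
Qed.

(** The test plane is spanned by f and by the constant function, an
    eigenvector for d to which f is orthogonal. The same energy identity shows
    that no eigenvalue exceeds d. *)
Lemma regular_spectral_gap d (f : G -> R) (e : R) :
  (forall x : G, #|[set y | edge x y]| = d) ->
  \sum_x f x = 0 -> 0 < \sum_x f x ^+ 2 ->
  \sum_x \sum_y (edge x y)%:R * (f x - f y) ^+ 2 <= (e * \sum_x f x ^+ 2) *+ 2 ->
  0 <= lambda1 R G - lambda2 R G <= e.
Proof.
move=> reg f0 fpos fe; have e0 : 0 <= e.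
  rewrite -(pmulr_lge0 _ fpos) -(pmulrn_lge0 _ (isT : (0 < 2)%N)).
  apply: le_trans fe; apply: sumr_ge0 => x _; apply: sumr_ge0 => y _.
  by rewrite mulr_ge0 ?sqr_ge0.
have sqE : \sum_x f x ^+ 2 = mxform 1%:M (rowf f) (rowf f).
  by rewrite form1E; apply: eq_bigr => x _; rewrite expr2.
have deg (x : G) : \sum_y (edge x y)%:R = d%:R :> R by rewrite sum_edge (reg x).
pose u := rowf (fun=> 1).
have uv : mxform 1%:M u (rowf f) = 0.
  by rewrite form1E -{2}f0; apply: eq_bigr => x _; rewrite mul1r.
have vu : mxform 1%:M (rowf f) u = 0.
  by rewrite form1E -[RHS]f0; apply: eq_bigr => x _; rewrite mulr1.
have vAu : mxform A (rowf f) u = 0.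
  transitivity (d%:R * \sum_x f x); last by rewrite f0 mulr0.
  rewrite form_adjE mulr_sumr; apply: eq_bigr => x _.
  by rewrite -(deg x) mulr_suml; apply: eq_bigr => y _; rewrite mulr1.
have uAv : mxform A u (rowf f) = 0.
  rewrite form_adjE exchange_big -[RHS]vAu form_adjE; apply: eq_bigr => x _.
  by apply: eq_bigr => y _; rewrite edge_sym mul1r mulr1.
have uu : 0 < mxform 1%:M u u.
  rewrite form1E lt_def sumr_ge0 ?andbT => [|x _]; last by rewrite mulr1.
  apply: contraTneq fpos => /psumr_eq0P z; rewrite big1 ?ltxx // => x _.
  by have /eqP := z (fun x _ => mulr_ge0 ler01 ler01) x isT; rewrite mulr1 oner_eq0.
have uAu : mxform A u u = d%:R * mxform 1%:M u u.
  rewrite form_adjE form1E mulr_sumr; apply: eq_bigr => x _.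
  by rewrite -(deg x) mulr_suml; apply: eq_bigr => y _.
rewrite (_ : e = d%:R - (d%:R - e)); last by rewrite subKr.
apply: (spectral_gap_le (u := u) (v := rowf f) tr_adjacency_mx) => //.
- move=> w; rewrite (rowfK w) -subr_ge0 -(pmulrn_lge0 _ (isT : (0 < 2)%N)).
  rewrite -regular_form //; apply: sumr_ge0 => x _; apply: sumr_ge0 => y _.
  by rewrite mulr_ge0 ?sqr_ge0.
- by rewrite -sqE.
- by rewrite uAu ler_pM2r // gerBl.
move: fe; rewrite (regular_form f reg) sqE lerMn2r /=; lra.
Qed.

End RegularGraphs.

Section SearchTrees.
Variable G : sgraph.
Implicit Types (C D : {set G}) (T : {ffun G -> option G}) (a b c e r u v w x y z : G).

(** * Subtrees of a parent function *)

Lemma subtree_refl T x : x \in subtree T x.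
Proof. by rewrite inE connect0. Qed.

Lemma subtree_trans T x y z :
  x \in subtree T y -> y \in subtree T z -> x \in subtree T z.
Proof. by rewrite !inE; exact: connect_trans. Qed.

Lemma subtree_parent T x y : T x = Some y -> x \in subtree T y.
Proof. by move=> Tx; rewrite inE connect1 //= Tx. Qed.

Lemma subtree_step T x y z :
  T x = Some y -> y \in subtree T z -> x \in subtree T z.
Proof. by move/subtree_parent; exact: subtree_trans. Qed.

Lemma subtree_ind T w (P : G -> Prop) : P w ->
  (forall b e, T b = Some e -> e \in subtree T w -> P e -> P b) ->
  forall b, b \in subtree T w -> P b.
Proof.
move=> Pw Pstep b; rewrite inE => /connectP[s + ws].
elim: s b ws => [|e s IH] b /= ws; first by rewrite -ws.
case/andP=> /eqP Tb es; apply: (Pstep _ e) => //; last exact: IH.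
by rewrite inE; apply/connectP; exists s.
Qed.

Lemma subtreeP T b w :
  b \in subtree T w -> b = w \/ exists2 e, T b = Some e & e \in subtree T w.
Proof.
move: b; apply: subtree_ind; first by left.
by move=> b e Tb ew _; right; exists e.
Qed.

Lemma subtree_comparable T b x y : b \in subtree T x -> b \in subtree T y ->
  x \in subtree T y \/ y \in subtree T x.
Proof.
move: b; apply: subtree_ind; first by left.
move=> b e Tb ex IH /subtreeP[<-|[e']].
  by right; apply: subtree_step Tb _.
by rewrite Tb => -[<-]; exact: IH.
Qed.

Lemma subtree_child T b w : b \in subtree T w -> b != w ->
  exists2 c, T c = Some w & b \in subtree T c.
Proof.
move: b; apply: subtree_ind; first by rewrite eqxx.
move=> b e Tb ew IH bw; have [ew'|/IH[c Tc ec]] := eqVneq e w.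
  by exists b; rewrite ?subtree_refl -?ew'.
by exists c => //; apply: subtree_step Tb ec.
Qed.

Definition adjacent u (S : {set G}) := [exists x in S, edge u x].

Lemma adjacentP u (S : {set G}) :
  reflect (exists2 x, x \in S & edge u x) (adjacent u S).
Proof. exact: exists_inP. Qed.

(** A local criterion for search trees. The rank excludes cycles; tree_edge and
    tree_adj together say that the subtrees of the children of w are the
    components of the subtree of w deprived of w: no edge joins two of them, and
    each of them is connected. The equivalence with search_tree_on, for a
    connected graph, is search_tree_is_tree and tree_search_tree_on. *)
Record is_tree T : Prop := IsTree {
  tree_rank : exists h : G -> nat, forall b e, T b = Some e -> (h e < h b)%N;
  tree_root : forall a b, T a = None -> T b = None -> a = b;
  tree_edge : forall a b, edge a b -> a \in subtree T b \/ b \in subtree T a;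
  tree_adj : forall v u, T v = Some u -> adjacent u (subtree T v)
}.

Lemma subtree_rank T (h : G -> nat) b w :
  (forall b e, T b = Some e -> (h e < h b)%N) ->
  b \in subtree T w -> b = w \/ (h w < h b)%N.
Proof.
move=> hT; move: b; apply: subtree_ind; first by left.
move=> b e /hT eb _ [<-|we]; right => //; exact: ltn_trans eb.
Qed.

Lemma subtree_anti T b w : is_tree T ->
  b \in subtree T w -> w \in subtree T b -> b = w.
Proof.
case=> -[h hT] _ _ _ /(subtree_rank hT)[//|wb] /(subtree_rank hT)[//|bw].
by move: (ltn_trans wb bw); rewrite ltnn.
Qed.

Lemma parentN T b e : is_tree T -> T b = Some e -> e \notin subtree T b.
Proof.
move=> tT; have [[h hT] _ _ _] := tT; move=> Tb; apply/negP => eb.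
have E := subtree_anti tT eb (subtree_parent Tb).
by move: (hT _ _ Tb); rewrite E ltnn.
Qed.

Lemma tree_top T : is_tree T -> G ->
  exists r, T r = None /\ forall b, b \in subtree T r.
Proof.
case=> -[h hT] root _ _ x0.
have up b : exists r, T r = None /\ b \in subtree T r.
  have [n] := ubnP (h b); elim: n b => // n IH b bn.
  case Tb: (T b) => [e|]; last by exists b; rewrite subtree_refl.
  have [|r [Tr er]] := IH e; first exact: leq_trans (hT _ _ Tb) bn.
  by exists r; split=> //; apply: subtree_step er.
have [r [Tr _]] := up x0; exists r; split=> // b.
by have [r' [Tr' br']] := up b; rewrite (root _ _ Tr Tr').
Qed.

(** * Rotations *)

Section Rotation.
Variables (T : {ffun G -> option G}) (u v : G).
Hypotheses (tT : is_tree T) (Tv : T v = Some u).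
Local Notation T' := (rotate T u v).

Lemma neq_uv : u != v.
Proof. by apply: contraL (parentN tT Tv) => /eqP->; rewrite negbK subtree_refl. Qed.

Lemma rotate_v : T' v = T u. Proof. by rewrite ffunE eqxx. Qed.

Lemma rotate_u : T' u = Some v.
Proof. by rewrite ffunE eqxx (negbTE neq_uv). Qed.

Lemma rotate_mid w : T w = Some v ->
  T' w = if adjacent u (subtree T w) then Some u else Some v.
Proof.
move=> Tw; rewrite ffunE Tw eqxx.
have -> : (w == v) = false.
  by apply: contraNF (parentN tT Tw) => /eqP->; exact: subtree_refl.
suff -> : (w == u) = false by [].
apply: contraNF (parentN tT Tv) => /eqP <-; exact: subtree_parent.
Qed.

Lemma rotate_other w : w != u -> w != v -> T w != Some v -> T' w = T w.
Proof. by move=> wu wv Tw; rewrite ffunE (negbTE wu) (negbTE wv) (negbTE Tw). Qed.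

Lemma rotate_cases b :
  [\/ b = v, b = u, T b = Some v | T' b = T b].
Proof.
have [->|bv] := eqVneq b v; first by constructor 1.
have [->|bu] := eqVneq b u; first by constructor 2.
have [E|Tb] := eqVneq (T b) (Some v); first by constructor 3.
by constructor 4; exact: rotate_other.
Qed.

Lemma rotate_u_below_v : u \in subtree T' v.
Proof. by apply: subtree_parent rotate_u. Qed.

(** Only u can lose descendants in the uv-rotation. *)
Lemma subtree_rotate_ge w b : w != u -> b \in subtree T w -> b \in subtree T' w.
Proof.
move=> wu; move: b; apply: subtree_ind => [|b e Tb ew IH].
  exact: subtree_refl.
case: (rotate_cases b) => [bv|bu|bv|E].
- have eu : e = u by move: Tb; rewrite bv Tv => -[].
  move: IH; rewrite eu => /subtreeP[uw|[z]]; first by rewrite uw eqxx in wu.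
  by rewrite rotate_u => -[<-]; rewrite bv.
- have vw : v \in subtree T' w by apply: subtree_step IH; rewrite rotate_v -bu.
  by rewrite bu; apply: subtree_trans rotate_u_below_v vw.
- have ev : e = v by move: Tb; rewrite bv => -[].
  move: IH; rewrite ev => vw; have := rotate_mid bv.
  case: ifP => _ T'b; last exact: subtree_step T'b vw.
  apply: subtree_step T'b _; exact: subtree_trans rotate_u_below_v vw.
- by apply: subtree_step IH; rewrite E.
Qed.

Lemma subtree_rotate_top b : b \in subtree T u -> b \in subtree T' v.
Proof.
move: b; apply: subtree_ind => [|b e Tb eu IH]; first exact: rotate_u_below_v.
case: (rotate_cases b) => [->|->|bv|E].
- exact: subtree_refl.
- exact: rotate_u_below_v.
- have := rotate_mid bv; case: ifP => _ /subtree_step; apply.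
    exact: rotate_u_below_v.
  exact: subtree_refl.
- by apply: subtree_step IH; rewrite E.
Qed.

(** What u loses: v, and the subtrees of v to which u is not adjacent. *)
Lemma subtree_rotate_lost b : b \in subtree T u ->
  [\/ b \in subtree T' u, b = v |
   exists c, [/\ T c = Some v, b \in subtree T c & ~~ adjacent u (subtree T c)]].
Proof.
move: b; apply: subtree_ind => [|b e Tb eu IH].
  by constructor 1; exact: subtree_refl.
case: (rotate_cases b) => [->|->|bv|E].
- by constructor 2.
- by constructor 1; exact: subtree_refl.
- have := rotate_mid bv; case: ifP => adj T'b.
    by constructor 1; apply: subtree_parent.
  by constructor 3; exists b; rewrite adj subtree_refl.
- case: IH => [eu'|ev|[c [Tc ec nadj]]].
  + by constructor 1; apply: subtree_step eu'; rewrite E.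
  + have Tb' : T b = Some v by rewrite Tb ev.
    have := rotate_mid Tb'; case: ifP => adj T'b.
      by constructor 1; apply: subtree_parent.
    by constructor 3; exists b; rewrite adj subtree_refl.
  + by constructor 3; exists c; split=> //; apply: subtree_step Tb ec.
Qed.

Lemma subtree_rotate_le w b : w != u -> w != v ->
  b \in subtree T' w -> b \in subtree T w.
Proof.
move=> wu wv; move: b; apply: subtree_ind => [|b e T'b ew IH].
  exact: subtree_refl.
have uw : u \in subtree T w -> v \in subtree T w by exact: subtree_step.
case: (rotate_cases b) => [bv|bu|bv|E].
- rewrite bv; apply: uw; apply: subtree_step IH.
  by move: T'b; rewrite bv rotate_v.
- have /subtreeP[vw|[z]] : v \in subtree T w.
  + by move: T'b; rewrite bu rotate_u => -[->].
  + by rewrite vw eqxx in wv.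
  + by rewrite Tv => -[<-]; rewrite bu.
- move: T'b; rewrite (rotate_mid bv) => T'b; apply: subtree_step bv _; move: T'b.
  by case: ifP => _ [ev]; rewrite -ev in IH; rewrite ?IH ?uw.
- by apply: subtree_step IH; rewrite -E.
Qed.

(** The only delicate points concern u. It stays comparable with its
    neighbours, since the subtrees it loses contain none of them. And v is
    adjacent to the new subtree of u: u has a neighbour in the old subtree of v,
    which is either v itself or a vertex of some child c of v; this c moves below
    u, and v has a neighbour in the subtree of c. *)
Lemma rotate_is_tree : is_tree T'.
Proof.
have [[h hT] root edg adj] := tT.
split.
- (* Doubling the ranks makes room for u between v, which takes its place, and
     the vertices below. *)
  exists (fun w => if w == v then (h u).*2 else if w == u then (h u).*2.+1
                   else (h w).*2) => b e.
  have uv := negbTE neq_uv; have vu : (v == u) = false by rewrite eq_sym.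
  have huv := hT _ _ Tv.
  case: (rotate_cases b) => [->|->|bv|E].
  + rewrite rotate_v eqxx => Tu; have eu := hT _ _ Tu.
    have -> : (e == v) = false by apply: contraTF eu => /eqP->; rewrite -leqNgt ltnW.
    have -> : (e == u) = false by apply: contraTF eu => /eqP->; rewrite ltnn.
    by rewrite ltn_double.
  + by rewrite rotate_u uv eqxx => -[<-]; rewrite eqxx.
  + have vb := hT _ _ bv; rewrite (rotate_mid bv).
    have -> : (b == v) = false by apply: contraTF vb => /eqP->; rewrite ltnn.
    have -> : (b == u) = false by apply: contraTF vb => /eqP->; rewrite -leqNgt ltnW.
    have ub := ltn_trans huv vb.
    case: ifP => _ [<-]; rewrite ?eqxx ?uv ?ltn_double //.
    by rewrite ltn_Sdouble.
  + rewrite E => Tb; have eb := hT _ _ Tb.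
    have [bv|bv] := eqVneq b v.
      by move: E; rewrite bv rotate_v Tv => Tu; move: (hT _ _ Tu); rewrite ltnn.
    have [bu|bu] := eqVneq b u.
      by move: E; rewrite bu rotate_u => /esym Tu; move: (ltn_trans huv (hT _ _ Tu)); rewrite ltnn.
    have [ev|ev] := eqVneq e v; first by rewrite ltn_double (ltn_trans huv) // -ev.
    have [eu|eu] := eqVneq e u; first by rewrite ltn_Sdouble -eu.
    by rewrite ltn_double.
- have up b : T' b = None -> b = v /\ T u = None \/ T b = None /\ b != u.
    have [->|bu] := eqVneq b u; first by rewrite rotate_u.
    case: (rotate_cases b) => [->|E|bv|->].
    + by rewrite rotate_v; left.
    + by rewrite E eqxx in bu.
    + by rewrite (rotate_mid bv); case: ifP.
    + by right.
  move=> a b /up[[-> Tu]|[Ta au]] /up[[-> Tu']|[Tb bu]] //; last exact: root.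
    by rewrite (root _ _ Tb Tu) eqxx in bu.
  by rewrite (root _ _ Ta Tu') eqxx in au.
- move=> a b ab; have H x y : edge x y -> y \in subtree T x ->
      x \in subtree T' y \/ y \in subtree T' x.
    move=> xy yx; have [xu|xu] := eqVneq x u; last by right; exact: subtree_rotate_ge.
    rewrite xu in xy yx *; case: (subtree_rotate_lost yx) => [|->|[c [Tc yc]]].
    + by right.
    + by left; exact: rotate_u_below_v.
    + by case/negP; apply/adjacentP; exists y.
  case: (edg _ _ ab); last exact: H.
  by rewrite edge_sym in ab; case/(H _ _ ab); [right|left].
- have Hs w e : w != u -> adjacent e (subtree T w) -> adjacent e (subtree T' w).
    by move=> wu /adjacentP[x xw ex]; apply/adjacentP; exists x => //; exact: subtree_rotate_ge.
  have vu : v != u by rewrite eq_sym neq_uv.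
  move=> c e; case: (rotate_cases c) => [->|->|cv|E].
  + rewrite rotate_v => /adj/adjacentP[x xu ex]; apply/adjacentP; exists x => //.
    exact: subtree_rotate_top.
  + rewrite rotate_u => -[<-].
    have /adjacentP[x xv ux] := adj _ _ Tv.
    have [xv'|xv'] := eqVneq x v.
      by apply/adjacentP; exists u; rewrite ?subtree_refl // edge_sym -xv'.
    have [c' Tc' xc'] := subtree_child xv xv'.
    have ac' : adjacent u (subtree T c') by apply/adjacentP; exists x.
    have := rotate_mid Tc'; rewrite ac' => T'c'.
    have /adjacentP[z zc vz] := adj _ _ Tc'.
    apply/adjacentP; exists z => //; apply: subtree_trans (subtree_parent T'c').
    apply: subtree_rotate_ge => //; apply: contraNneq (parentN tT Tv) => <-.
    exact: subtree_parent.
  + have cu : c != u.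
      by apply: contraNneq (parentN tT Tv) => <-; exact: subtree_parent.
    rewrite (rotate_mid cv); case: ifP => ac [<-]; apply: Hs => //.
    exact: adj.
  + rewrite E => Tc; apply: Hs; last exact: adj.
    apply/eqP => cu; move: E; rewrite cu rotate_u => /esym Tu.
    by have := parentN tT Tv; rewrite (subtree_parent Tu).
Qed.

End Rotation.
End SearchTrees.

Section SearchTreeCriterion.
Variable G : sgraph.
Implicit Types (C D : {set G}) (T : {ffun G -> option G}) (a b c e r u v w x y z : G).

(** Among the children that u has after the rotation, those that come from v
    are adjacent to v by tree_adj, and the old ones are not by tree_edge; so the
    reverse rotation sends exactly the former back to v. *)
Lemma rotateK T u v : is_tree T -> T v = Some u ->
  rotate (rotate T u v) v u = T.
Proof.
move=> tT Tv; have tT' := rotate_is_tree tT Tv; have uv := neq_uv tT Tv.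
apply/ffunP => w; rewrite ffunE.
have [->|wu] := eqVneq w u; first by rewrite rotate_v.
have [->|wv] := eqVneq w v; first by rewrite Tv.
case: eqVneq => [T'w|T'w]; last first.
  have [E|] := eqVneq (T w) (Some v); last exact: rotate_other.
  by move: T'w; rewrite (rotate_mid tT Tv E) E; case: ifP; rewrite ?eqxx.
rewrite -/(adjacent v (subtree (rotate T u v) w)).
have [E|Tw] := eqVneq (T w) (Some v).
  suff -> : adjacent v (subtree (rotate T u v) w) by rewrite E.
  have /adjacentP[x xw vx] := tree_adj tT E.
  by apply/adjacentP; exists x => //; exact: (subtree_rotate_ge tT Tv).
have {}Tw : T w = Some u by rewrite -T'w rotate_other.
rewrite ifF ?Tw //; apply/negbTE/negP => /adjacentP[x /(subtree_rotate_le tT Tv wu wv) xw].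
have wvN y : T y = Some u -> forall z, T z = Some u -> y \in subtree T z -> y = z.
  move=> Ty z Tz /subtreeP[//|[e]]; rewrite Ty => -[<-].
  by rewrite (negbTE (parentN tT Tz)).
case/(tree_edge tT) => [vx|xv].
  by case/eqP: wv; apply/esym/(wvN v Tv w Tw); exact: subtree_trans vx xw.
case: (subtree_comparable xw xv) => [/(wvN w Tw v Tv)|/(wvN v Tv w Tw)] E.
  by rewrite E eqxx in wv.
by rewrite E eqxx in wv.
Qed.

(** After the uv-rotation the parent of u is v. Any other rotation giving u the
    parent v would force a cycle in T. *)
Lemma rotate_inj T u v u2 v2 : is_tree T -> T v = Some u -> T v2 = Some u2 ->
  rotate T u v = rotate T u2 v2 -> v = v2.
Proof.
move=> tT Tv Tv2 /ffunP /(_ u); rewrite (rotate_u tT Tv).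
have [[h hT] _ _ _] := tT; have uv := hT _ _ Tv.
have [uv2|u_v2] := eqVneq u v2.
  rewrite {1}uv2 rotate_v => /esym/hT vu2; rewrite uv2 in uv.
  by have := ltn_trans (ltn_trans (hT _ _ Tv2) uv) vu2; rewrite ltnn.
have [uu2|u_u2] := eqVneq u u2.
  by rewrite {1}uu2 (rotate_u tT Tv2) => -[].
have [E|Tu] := eqVneq (T u) (Some v2).
  rewrite (rotate_mid tT Tv2 E); case: ifP => _ [vE] //.
  move: (hT _ _ E) (hT _ _ Tv2); rewrite -vE => H1 H2.
  by have := ltn_trans (ltn_trans H2 H1) uv; rewrite ltnn.
rewrite rotate_other // => /esym/hT /(ltn_trans uv).
by rewrite ltnn.
Qed.

(** * Search trees as parent functions *)

Definition connected C := forall x y, x \in C -> y \in C -> connect (induced C) x y.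

Lemma connect_closed (e : rel G) (P : pred G) x y :
  (forall a b, P a -> e a b -> P b) -> P x -> connect e x y -> P y.
Proof.
move=> cl Px /connectP[s + ->]; elim: s x Px => //= z s IH x Px /andP[xz].
by apply: IH; exact: cl xz.
Qed.

Lemma induced_sym C : symmetric (induced C).
Proof. by move=> x y; rewrite /induced edge_sym andbCA. Qed.

Lemma connect_induced_sym C : connect_sym (induced C).
Proof. exact: sym_connect_sym (induced_sym C). Qed.

Lemma componentE C D x : D \in components C -> x \in D ->
  D = [set y in C | connect (induced C) x y].
Proof.
case/imsetP => z zC -> ; rewrite inE => /andP[xC zx]; apply/setP => y.
by rewrite !inE (same_connect (connect_induced_sym C) zx).
Qed.

Lemma component_edge C D x y :
  D \in components C -> x \in D -> y \in C -> edge x y -> y \in D.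
Proof.
move=> DC xD yC xy; rewrite (componentE DC xD) inE yC connect1 //.
by rewrite /induced xy yC (mem_component DC xD).
Qed.

Lemma component_connected C D : D \in components C -> connected D.
Proof.
move=> DC x y xD yD; have := yD; rewrite {1}(componentE DC xD) inE => /andP[_].
apply: (connect_closed (P := connect (induced D) x)) => [a b xa|]; last exact: connect0.
case/and3P=> aC bC ab; apply: connect_trans (xa) (connect1 _).
have aD : a \in D.
  by apply: (connect_closed (P := mem D) _ xD xa) => c e /= _ /and3P[].
by rewrite /induced ab aD (component_edge DC aD).
Qed.

(** The induction invariant: [C] has to be connected so that its root is
    adjacent to the subtree of each of its children. *)
Lemma search_tree_on_props T C o : search_tree_on T C o -> connected C ->
  exists r, [/\ r \in C, T r = o, {in C, forall b, b \in subtree T r},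
    {in C &, forall a b, edge a b -> a \in subtree T b \/ b \in subtree T a} &
    {in C, forall v, v = r \/ exists2 u, T v = Some u & adjacent u (subtree T v)}].
Proof.
elim=> {}C {}o r rC Tr _ IH conC.
have {}IH D (DC : D \in components (C :\ r)) := IH D DC (component_connected DC).
have inD b : b \in C -> b != r -> exists2 D, D \in components (C :\ r) & b \in D.
  by move=> bC br; apply: component_cover; rewrite !inE br.
have top : {in C, forall b, b \in subtree T r}.
  move=> b bC; have [->|br] := eqVneq b r; first exact: subtree_refl.
  have [D DC bD] := inD b bC br; have [r' [_ Tr' sub _ _]] := IH D DC.
  exact: subtree_trans (sub b bD) (subtree_parent Tr').
exists r; split=> // [a b aC bC ab|v vC].
  have [->|ar] := eqVneq a r; first by right; exact: top.
  have [->|br] := eqVneq b r; first by left; exact: top.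
  have [D DC aD] := inD a aC ar; have [_ [_ _ _ edg _]] := IH D DC.
  by apply: edg => //; apply: component_edge DC aD _ ab; rewrite !inE br.
have [->|vr] := eqVneq v r; [by left|right].
have [D DC vD] := inD v vC vr; have [r' [r'D Tr' sub _ adj]] := IH D DC.
have [vE|//] := adj v vD; exists r; first by rewrite vE.
apply/adjacentP; rewrite vE; apply: contrapT => nadj.
suff : r \in D by move/(mem_component DC); rewrite !inE eqxx.
apply: (connect_closed (P := mem D) _ vD (conC v r vC rC)) => a b /= aD.
case/and3P=> aC bC ab; have [br|br] := eqVneq b r.
  by case: nadj; exists a; [exact: sub|rewrite edge_sym -br].
by apply: component_edge DC aD _ ab; rewrite !inE br.
Qed.

Lemma search_tree_is_tree T : connected [set: G] ->
  search_tree_on T [set: G] None -> is_tree T.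
Proof.
move=> conG /search_tree_on_props/(_ conG)[r [_ Tr top edg adj]].
have acyc b e : T b = Some e -> e \notin subtree T b.
  move=> Tb; apply/negP => eb.
  (* If b were on a cycle, all its ancestors would be descendants of b, the
     root included. *)
  have cyc s : path (fun x y => T x == Some y) b s -> last b s \in subtree T b.
    elim/last_ind: s => [|s x IH] /=; first by rewrite subtree_refl.
    rewrite rcons_path last_rcons => /andP[/IH + /eqP Tx].
    by case/subtreeP=> [E|[y]]; [move: Tx; rewrite E Tb => -[<-]|rewrite Tx => -[->]].
  have : b \in subtree T r := top b (in_setT b).
  rewrite inE => /connectP[s /cyc + rE]; rewrite -rE => /subtreeP[rb|[y]].
    by rewrite -rb Tr in Tb.
  by rewrite Tr.
split.
- exists (fun b => #|[set w | b \in subtree T w]|) => b e Tb; apply: proper_card.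
  apply/properP; split.
    by apply/subsetP => w; rewrite !inE => ew; apply: connect_trans ew; rewrite connect1 //= Tb.
  by exists b; rewrite inE ?subtree_refl // acyc.
- have uniq a : T a = None -> a = r.
    by move=> Ta; case/subtreeP: (top a (in_setT a)) => // -[e]; rewrite Ta.
  by move=> a b /uniq-> /uniq->.
- by move=> a b; apply: edg; rewrite in_setT.
- move=> v u Tv; case: (adj v (in_setT v)) => [vr|[w]].
    by rewrite vr Tr in Tv.
  by rewrite Tv => -[->].
Qed.

(** By induction: each child's subtree is connected and is adjacent to w. *)
Lemma subtree_connected T w : is_tree T -> connected (subtree T w).
Proof.
move=> tT; suff H : forall x, x \in subtree T w -> connect (induced (subtree T w)) x w.
  move=> x y xw yw; apply: connect_trans (H x xw) _.
  by rewrite connect_induced_sym H.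
have [n] := ubnP #|subtree T w|; elim: n w => // n IH w lt x xw.
have [->|xw'] := eqVneq x w; first exact: connect0.
have [c Tc xc] := subtree_child xw xw'.
have cw : subtree T c \subset subtree T w.
  by apply/subsetP => z zc; apply: subtree_trans zc (subtree_parent Tc).
have {}IH y : y \in subtree T c -> connect (induced (subtree T w)) y c.
  move=> yc; apply: connect_sub (IH c _ y yc) => [a b /and3P[ac bc ab]|].
    by rewrite connect1 // /induced ab !(subsetP cw).
  rewrite ltnS in lt; apply: leq_trans lt; apply: proper_card.
  apply/properP; split=> //; exists w; first exact: subtree_refl.
  exact: parentN Tc.
have /adjacentP[y yc wy] := tree_adj tT Tc.
apply: connect_trans (IH x xc) _; rewrite connect_induced_sym.
apply: connect_trans (IH y yc); apply: connect1.
by rewrite /induced wy subtree_refl (subsetP cw).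
Qed.

(** The components of the subtree of w without w are the subtrees of the
    children of w. *)
Lemma tree_search_tree_on T w : is_tree T -> search_tree_on T (subtree T w) (T w).
Proof.
move=> tT; have [n] := ubnP #|subtree T w|; elim: n w => // n IH w lt.
apply: (@SearchTreeOn _ _ _ _ w) => // [|D]; first exact: subtree_refl.
set C := subtree T w :\ w => DC.
have [y yD] : exists y, y \in D.
  case/imsetP: DC => y yC ->; exists y; by rewrite inE yC connect0.
have := mem_component DC yD; rewrite !in_setD1 => /andP[yw' yw].
have [c Tc yc] := subtree_child yw yw'.
have cwN : w \notin subtree T c := parentN tT Tc.
have cC : subtree T c \subset C.
  apply/subsetP => z zc; rewrite in_setD1.
  rewrite (subtree_trans zc (subtree_parent Tc)) andbT.
  by apply: contraNneq cwN => <-.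
suff -> : D = subtree T c.
  rewrite -Tc; apply: IH; rewrite ltnS in lt; apply: leq_trans lt.
  apply: proper_card; apply/properP; split; last by exists w; rewrite ?subtree_refl.
  by apply: subset_trans cC _; exact: subD1set.
rewrite (componentE DC yD); apply/setP => z; rewrite inE.
apply/andP/idP => [[zC yz]|zc]; last first.
  split; first exact: (subsetP cC).
  apply: connect_sub (subtree_connected tT yc zc) => a b /and3P[ac bc ab].
  by rewrite connect1 // /induced ab !(subsetP cC).
apply: (connect_closed (P := mem (subtree T c)) _ yc yz) => a b /= ac.
case/and3P=> _; rewrite in_setD1 => /andP[bw' bw] ab.
case: (tree_edge tT ab) => [ab'|ba]; last exact: subtree_trans ba ac.
case: (subtree_comparable ab' ac) => // cb.
case/subtreeP: cb => [<-|[e]]; first exact: subtree_refl.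
by rewrite Tc => -[<-] /(subtree_anti tT bw) bE; rewrite bE eqxx in bw'.
Qed.


End SearchTreeCriterion.

(** * Regularity of the rotation graph *)

Section Regularity.
Variable G : sgraph.
Hypothesis conG : connected [set: G].
Variable x0 : G.
Implicit Types (T : searchTree G) (u v w x y : G).

Lemma searchTree_is_tree T : is_tree T.
Proof. by apply: search_tree_is_tree => //; case: T => T /= /asboolP. Qed.

Lemma is_tree_searchTree (t : {ffun G -> option G}) :
  is_tree t -> exists T, parent T = t.
Proof.
move=> tt; have [r [tr top]] := tree_top tt x0.
have st : `[< search_tree_on t [set: G] None >].
  apply/asboolP; rewrite -tr; have -> : [set: G] = subtree t r.
    by apply/setP => b; rewrite in_setT top.
  exact: tree_search_tree_on.
by exists (SearchTree st).
Qed.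

Lemma rotates_toP T T' :
  reflect (exists u v, T v = Some u /\ parent T' = rotate T u v) (rotates_to T T').
Proof.
apply: (iffP existsP) => [[u /existsP[v /andP[/eqP Tv /eqP E]]]|[u [v [Tv E]]]].
  by exists u, v.
by exists u; apply/existsP; exists v; rewrite Tv E !eqxx.
Qed.

Lemma rotates_to_sym T T' : rotates_to T T' -> rotates_to T' T.
Proof.
case/rotates_toP=> u [v [Tv E]]; apply/rotates_toP; exists v, u.
have tT := searchTree_is_tree T.
by rewrite E (rotate_u tT Tv) (rotateK tT Tv).
Qed.

Lemma rotation_edgeE T T' : rotation_edge T T' = rotates_to T T'.
Proof. by apply/orP/idP => [[//|/rotates_to_sym]|]; [|left]. Qed.

(** Each non-root vertex v of T gives one rotation, and distinct v give distinct
    trees. Rotations towards T give no further neighbours, being the inverses of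
    rotations from T. *)
Lemma rotation_graph_regular (T : rotation_graph G) :
  #|[set T' | edge T T']| = #|G|.-1.
Proof.
have tT := searchTree_is_tree T; have [r [Tr top]] := tree_top tT x0.
have noneE v : ((T : searchTree G) v == None) = (v == r).
  apply/eqP/eqP => [Tv|->//]; exact: (tree_root tT).
pose rot v := insubd (T : searchTree G) (rotate T (odflt v ((T : searchTree G) v)) v).
have rotE u v : (T : searchTree G) v = Some u -> parent (rot v) = rotate T u v.
  move=> Tv; rewrite /rot Tv /=.
  have [T' T'E] := is_tree_searchTree (rotate_is_tree tT Tv).
  by rewrite -T'E -[LHS]/(val _) valKd.
have -> : [set T' | edge T T'] = rot @: [set~ r].
  apply/setP => T'; rewrite inE; apply/idP/imsetP => [|[v]].
    rewrite /= rotation_edgeE => /rotates_toP[u [v [Tv E]]].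
    exists v; first by rewrite !inE -noneE Tv.
    by apply: val_inj; rewrite /= (rotE _ _ Tv).
  rewrite !inE -noneE; case Tv: ((T : searchTree G) v) => [u|//] _ ->.
  by rewrite /= rotation_edgeE; apply/rotates_toP; exists u, v; rewrite (rotE _ _ Tv).
rewrite card_in_imset ?cardsC1 // => v v2; rewrite !inE -!noneE.
case Tv: ((T : searchTree G) v) => [u|//] _.
case Tv2: ((T : searchTree G) v2) => [u2|//] _ /(congr1 (@parent G)).
by rewrite (rotE _ _ Tv) (rotE _ _ Tv2); apply: rotate_inj.
Qed.

End Regularity.

(** * Action of graph automorphisms on search trees *)

Section Automorphisms.
Variables (G : sgraph) (s : G -> G).
Hypotheses (conG : connected [set: G]) (x0 : G).
Hypotheses (sK : involutive s) (s_edge : forall a b, edge (s a) (s b) = edge a b).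
Implicit Types (t : {ffun G -> option G}) (T : searchTree G).

(** The image of the tree [t] under s, which is its own inverse. *)
Definition relabel t : {ffun G -> option G} := [ffun w => omap s (t (s w))].

Lemma relabelE t a b : relabel t (s a) = Some (s b) <-> t a = Some b.
Proof.
by rewrite ffunE sK; case: (t a) => [c|] /=; split=> // -[]; [move/(inv_inj sK)|]=> ->.
Qed.

Lemma relabelK : involutive relabel.
Proof.
by move=> t; apply/ffunP => w; rewrite !ffunE sK; case: (t w) => //= c; rewrite sK.
Qed.

Lemma subtree_relabel t a b :
  (s b \in subtree (relabel t) (s a)) = (b \in subtree t a).
Proof.
have H t' x y : y \in subtree t' x -> s y \in subtree (relabel t') (s x).
  move: y; apply: subtree_ind => [|y e t'y _]; first exact: subtree_refl.
  by apply: subtree_step; apply/relabelE.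
by apply/idP/idP => /H //; rewrite relabelK !sK.
Qed.

Lemma relabel_is_tree t : is_tree t -> is_tree (relabel t).
Proof.
case=> -[h ht] root edg adj; split.
- by exists (h \o s) => b e; rewrite -[b]sK -[e]sK => /relabelE/ht; rewrite /= !sK.
- have H a : relabel t a = None -> t (s a) = None by rewrite ffunE; case: (t _).
  by move=> a b /H ta /H tb; apply: (inv_inj sK); exact: root.
- by move=> a b; rewrite -[a]sK -[b]sK s_edge !subtree_relabel; exact: edg.
- move=> v u; rewrite -[v]sK -[u]sK => /relabelE/adj/adjacentP[x xv ux].
  by apply/adjacentP; exists (s x); rewrite ?subtree_relabel ?s_edge.
Qed.

Definition relabelT T : searchTree G := insubd T (relabel T).

Lemma parent_relabelT T : parent (relabelT T) = relabel T.
Proof.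
have tT := relabel_is_tree (searchTree_is_tree conG T).
have [T' T'E] := is_tree_searchTree x0 tT.
by rewrite /relabelT -T'E -[LHS]/(val _) valKd.
Qed.

Lemma relabelTK : involutive relabelT.
Proof. by move=> T; apply: val_inj; rewrite /= !parent_relabelT relabelK. Qed.

Lemma card_relabel (P P' : pred (searchTree G)) :
  (forall T, P' (relabelT T) = P T) -> #|[set T | P T]| = #|[set T | P' T]|.
Proof.
move=> PP; rewrite -!sum1dep_card [RHS](reindex relabelT).
  by apply: eq_bigl => T; rewrite PP.
exact/onW_bij/inv_bij/relabelTK.
Qed.

End Automorphisms.

(** * Search trees of complete bipartite graphs *)

Section CompleteBipartite.
Variables (p q : nat).
Hypotheses (p_gt0 : (0 < p)%N) (q_gt0 : (0 < q)%N).
Local Notation K := (complete_bipartite p q).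
Implicit Types (t : {ffun K -> option K}) (T : searchTree K).

Definition inQ (w : K) : bool := if w is inr _ then true else false.

Lemma edge_bipartite (a b : K) : edge a b = (inQ a != inQ b).
Proof. by case: a b => a [] b. Qed.

Lemma connected_bipartite : connected [set: K].
Proof.
have step (a b : K) : edge a b -> connect (induced [set: K]) a b.
  by move=> ab; rewrite connect1 // /induced !in_setT.
have stepC (a b : K) : edge b a -> connect (induced [set: K]) a b.
  by rewrite edge_sym; exact: step.
move=> x y _ _; case: x y => a [] b; do ?exact: step.
  by apply: (@connect_trans _ _ (inr (Ordinal q_gt0) : K)); exact: step.
by apply: (@connect_trans _ _ (inl (Ordinal p_gt0) : K)); exact: step.
Qed.

(** There are no edges inside Q, so by tree_adj no vertex of such a subtree has
    its parent in it. *)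
Lemma subtree_Q_leaf t c z : is_tree t ->
  (forall a, a \in subtree t c -> inQ a) -> z \in subtree t c -> z = c.
Proof.
move=> tt cQ zc; case/subtreeP: (zc) => // -[e tz ec].
have /adjacentP[a az] := tree_adj tt tz.
by rewrite edge_bipartite (cQ e ec) (cQ a) // (subtree_trans az zc).
Qed.

(** By subtree_rotate_lost, x = u and either y = v, or y is in the subtree of a
    child c of v without neighbours of x. In the latter case that subtree lies in
    Q, since x is adjacent to the whole other side, so it reduces to y. *)
Lemma rotate_lost t u v (x y : K) : is_tree t -> t v = Some u ->
  inQ x -> inQ y -> y \in subtree t x -> y \notin subtree (rotate t u v) x ->
  [/\ u = x, y \in subtree t v & t y = Some x \/ obind t (t y) = Some x].
Proof.
move=> tt tv xQ yQ yx; have [xu|xu] := eqVneq x u; last first.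
  by rewrite (subtree_rotate_ge tt tv).
rewrite -{u}xu in tv *; case: (subtree_rotate_lost tt tv yx) => [->//|->|].
  by rewrite subtree_refl tv; split=> //; left.
case=> c [tc yc nadj] _; have cQ a : a \in subtree t c -> inQ a.
  move=> ac; apply: contraNT nadj => aP; apply/adjacentP; exists a => //.
  by rewrite edge_bipartite xQ (negbTE aP).
rewrite (subtree_Q_leaf tt cQ yc) tc /= tv; split=> //; last by right.
exact: subtree_parent tc.
Qed.

(** Every vertex a outside Q is adjacent, hence comparable, to both x and y; as
    these are incomparable, a is above both. So the subtrees of x and y lie in Q,
    and their parents lie outside Q, hence each parent is above both x and y;
    the two parents are then above each other. *)
Lemma incomparable_siblings t x y : is_tree t -> inQ x -> inQ y ->
  y \notin subtree t x -> x \notin subtree t y ->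
  exists2 z, t x = Some z & t y = Some z.
Proof.
move=> tt xQ yQ yx xy.
have [r [tr top]] := tree_top tt x.
have half a b : inQ a -> inQ b -> b \notin subtree t a -> a \notin subtree t b ->
    exists z, [/\ t a = Some z, ~~ inQ z & b \in subtree t z].
  move=> aQ bQ ba ab.
  have noP c : ~~ inQ c -> a \in subtree t c /\ b \in subtree t c.
    move=> cP; have ca : edge c a by rewrite edge_bipartite aQ (negbTE cP).
    have cb : edge c b by rewrite edge_bipartite bQ (negbTE cP).
    case: (tree_edge tt ca) => [c_a|ac]; case: (tree_edge tt cb) => [c_b|bc] //.
    - by case: (subtree_comparable c_a c_b) => H; [rewrite H in ab|rewrite H in ba].
    - by rewrite (subtree_trans bc c_a) in ba.
    - by rewrite (subtree_trans ac c_b) in ab.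
  case ta: (t a) => [z|]; last first.
    by have := top b; rewrite (tree_root tt tr ta) (negbTE ba).
  have /adjacentP[w wa zw] := tree_adj tt ta.
  have wQ : inQ w.
    apply: contraT => /noP[aw bw]; move: ba.
    by rewrite (subtree_anti tt aw wa) bw.
  move: zw; rewrite edge_bipartite wQ => zP; exists z; split=> //; first by case: inQ zP.
  by have [] := noP z _; case: inQ zP.
have [z [tx zP yz]] := half x y xQ yQ yx xy.
have [z' [ty z'P xz']] := half y x yQ xQ xy yx.
exists z => //; rewrite ty; congr Some; apply: (subtree_anti tt).
  have [yE|[e]] := subtreeP yz; first by rewrite -yE yQ in zP.
  by rewrite ty => -[->].
have [xE|[e]] := subtreeP xz'; first by rewrite -xE xQ in z'P.
by rewrite tx => -[->].
Qed.

(** One side forms a path, and the vertices of Q are leaves below its end. *)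
Lemma searchTree_exists : (0 < #|{: searchTree K}|)%N.
Proof.
have last_lt : (p.-1 < p)%N by rewrite prednK.
pose t : {ffun K -> option K} := [ffun w : K => match (w : 'I_p + 'I_q)%type with
  | inl a => if a == 0 :> nat then None else Some (inl (insubd a a.-1))
  | inr _ => Some (inl (Ordinal last_lt)) end].
have tr b : t (inr b) = Some (inl (Ordinal last_lt)) by rewrite ffunE.
have tl (a : 'I_p) c : t (inl a) = Some c -> exists2 k : 'I_p, c = inl k & a = k.+1 :> nat.
  rewrite ffunE; case: eqP => // /eqP a0 [<-]; exists (insubd a a.-1) => //.
  by rewrite val_insubd (leq_ltn_trans (leq_pred a)) // prednK // lt0n.
have Qsub (a : 'I_p) b : (inr b : K) \in subtree t (inl a).
  have [n] := ubnP (p - a); elim: n a => // n IH a lt.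
  have [aE|aE] := eqVneq (a : nat) p.-1.
    by apply: subtree_parent; rewrite tr; congr (Some (inl _)); apply: val_inj.
  have a1 : (a.+1 < p)%N.
    by rewrite -[X in (_ < X)%N](prednK p_gt0) ltnS ltn_neqAle aE -ltnS prednK ?ltn_ord.
  apply: subtree_trans (IH (Ordinal a1) _) (subtree_parent _).
    by rewrite /= -ltnS; apply: leq_trans lt; rewrite ltnS ltn_sub2l ?ltn_ord.
  rewrite ffunE /=; congr (Some (inl _)); apply: val_inj.
  by rewrite val_insubd /= ltn_ord.
have tt : is_tree t.
  split.
  - exists (fun w : K => if (w : 'I_p + 'I_q)%type is inl a then (a : nat) else p) => -[a|b] c.
      by case/tl=> k -> ->.
    by rewrite tr => -[<-] /=.
  - have root w : t w = None -> exists2 a : 'I_p, w = inl a & a = 0%N :> nat.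
      case: w => [a|b]; last by rewrite tr.
      by rewrite ffunE; case: eqP => // a0 _; exists a.
    move=> v w /root[a -> a0] /root[b -> b0]; congr inl.
    by apply: val_inj; rewrite /= a0 b0.
  - by move=> [a|a] [b|b] // _; [right|left].
  - move=> [a|b] u; last first.
      rewrite tr => -[<-]; apply/adjacentP; exists (inr b) => //.
      exact: subtree_refl.
    case/tl=> k -> _; apply/adjacentP; exists (inr (Ordinal q_gt0)) => //.
have [T _] := is_tree_searchTree (inl (Ordinal p_gt0) : K) tt.
by apply/card_gt0P; exists T.
Qed.

Definition swapQ (i j : 'I_q) (w : K) : K :=
  match w with inl a => inl a | inr b => inr (tperm i j b) end.

Lemma swapQK i j : involutive (swapQ i j).
Proof. by case=> a //=; rewrite tpermK. Qed.

Lemma swapQ_edge i j (a b : K) : edge (swapQ i j a) (swapQ i j b) = edge a b.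
Proof. by case: a b => a [] b. Qed.

Let x0 : K := inl (Ordinal p_gt0).
Let conK := connected_bipartite.

Definition act i j := @relabelT K (swapQ i j).

Lemma parent_act i j T : parent (act i j T) = relabel (swapQ i j) T.
Proof. exact: parent_relabelT conK x0 (swapQK i j) (swapQ_edge i j) T. Qed.

Lemma card_act i j (P P' : pred (searchTree K)) :
  (forall T, P' (act i j T) = P T) -> #|[set T | P T]| = #|[set T | P' T]|.
Proof. exact: card_relabel conK x0 (swapQK i j) (swapQ_edge i j) _ _. Qed.

Definition above (x y : K) T := (y != x) && (y \in subtree T x).

Definition shortly_above (x y : K) T := (T y == Some x) || (obind T (T y) == Some x).

Local Notation N := #|{: searchTree K}|.

Lemma card_above_swap i j :
  #|[set T | above (inr i) (inr j) T]| = #|[set T | above (inr j) (inr i) T]|.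
Proof.
apply: (card_act (i := i) (j := j)) => T.
rewrite /above parent_act eq_sym; congr (_ && _).
rewrite -(subtree_relabel (swapQK i j) T (inr i) (inr j)) /=.
by rewrite tpermL tpermR.
Qed.

Lemma card_shortly_above_swap i i' j : i != j -> i' != j ->
  #|[set T | shortly_above (inr i) (inr j) T]| = #|[set T | shortly_above (inr i') (inr j) T]|.
Proof.
move=> ij i'j; apply: (card_act (i := i) (j := i')) => T.
rewrite /shortly_above parent_act.
have i'E : inr i' = swapQ i i' (inr i) by rewrite /= tpermL.
have someE (o : option K) : (omap (swapQ i i') o == Some (inr i')) = (o == Some (inr i)).
  case: o => [c|//]; rewrite i'E; apply/eqP/eqP => [[E]|[->//]].
  by congr Some; apply: (inv_inj (swapQK i i')).
have atE (w : K) : relabel (swapQ i i') T (swapQ i i' w) = omap (swapQ i i') (T w).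
  by rewrite ffunE swapQK.
have atj : relabel (swapQ i i') T (inr j) = omap (swapQ i i') (T (inr j)).
  by rewrite -atE /= tpermD // eq_sym.
rewrite atj someE -[X in _ = _ || X]someE.
by case: (T (inr j)) => //= c; rewrite atE.
Qed.

(** Sum over all k != j in place of i: the terms are equal by symmetry, and
    each tree is counted at most twice, for the parent and the grandparent of
    [inr j]. *)
Lemma card_shortly_above i j : i != j ->
  (#|[set T | shortly_above (inr i) (inr j) T]| * q.-1 <= 2 * N)%N.
Proof.
move=> ij.
have -> : (#|[set T | shortly_above (inr i) (inr j) T]| * q.-1 =
    \sum_(k | k != j) #|[set T | shortly_above (inr k) (inr j) T]|)%N.
  rewrite (eq_bigr (fun=> #|[set T | shortly_above (inr i) (inr j) T]|)) => [|k kj]; last first.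
    exact: card_shortly_above_swap.
  rewrite sum_nat_const mulnC; congr (_ * _)%N.
  by rewrite -[q in LHS]card_ord -(cardC1 j).
under eq_bigr do rewrite -sum1dep_card big_mkcond /=.
rewrite exchange_big /= mulnC -sum_nat_const; apply: leq_sum => T _.
rewrite -big_mkcondr /= sum1dep_card.
have le1 (o : option K) : (#|[set k : 'I_q | o == Some (inr k)]| <= 1)%N.
  apply/card_le1_eqP => a b; rewrite !inE => /eqP-> /eqP[->] //.
apply: leq_trans (leq_add (le1 (T (inr j))) (le1 (obind T (T (inr j))))).
rewrite -cardsUI; apply: leq_trans (leq_addr _ _); apply: subset_leq_card.
by apply/subsetP => k; rewrite !inE => /andP[_].
Qed.

(** For incomparable x and y, lift x above the common parent z by a rotation.
    This is injective: z is still the parent of y, and the reverse rotation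
    recovers the tree. *)
Lemma card_incomparable i j : i != j ->
  (N <= 3 * #|[set T | above (inr i) (inr j) T]|)%N.
Proof.
move=> ij; set x : K := inr i; set y : K := inr j.
have xy : y != x by apply: contra_neq ij => -[].
pose I := [set T | ~~ above x y T & ~~ above y x T].
pose f T := insubd T (rotate T (odflt x (T x)) x).
have treeT T := searchTree_is_tree conK T.
have sib T : T \in I -> exists2 z, T x = Some z & T y = Some z.
  rewrite inE /above xy eq_sym xy /= => /andP[yx xy'].
  exact: incomparable_siblings.
have fE T z : T x = Some z -> parent (f T) = rotate T z x.
  move=> Tx; rewrite /f Tx /=.
  have [T' T'E] := is_tree_searchTree x0 (rotate_is_tree (treeT T) Tx).
  by rewrite -T'E -[LHS]/(val _) valKd.
have fy T z : T x = Some z -> T y = Some z -> f T y = Some z.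
  move=> Tx Ty; rewrite (fE _ _ Tx) rotate_other //.
    by apply: contraNneq (parentN (treeT T) Ty) => <-; exact: subtree_refl.
  by rewrite Ty; apply: contraNneq (parentN (treeT T) Tx) => -[->]; exact: subtree_refl.
have fI : (#|I| <= #|[set T | above x y T]|)%N.
  rewrite -(card_in_imset (f := f) (D := I)); last first.
    move=> T1 T2 /sib[z1 T1x T1y] /sib[z2 T2x T2y] E.
    have := fy _ _ T1x T1y; rewrite E (fy _ _ T2x T2y) => -[zE].
    apply: val_inj; rewrite /= -(rotateK (treeT T1) T1x) -(rotateK (treeT T2) T2x).
    by rewrite -(fE _ _ T1x) -(fE _ _ T2x) E zE.
  apply: subset_leq_card; apply/subsetP => _ /imsetP[T /sib[z Tx Ty] ->].
  rewrite inE /above xy /= (fE _ _ Tx) (subtree_rotate_top (treeT T) Tx) //.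
  exact: subtree_parent.
have -> : N = #|[set: searchTree K]| by rewrite cardsT.
have -> : [set: searchTree K] = [set T | above x y T] :|: [set T | above y x T] :|: I.
  by apply/setP => T; rewrite !inE; do 2!case: above.
apply: leq_trans (leq_card_setU _ _) _; rewrite mulSn mulSn mul1n addnA.
apply: leq_add fI; apply: leq_trans (leq_card_setU _ _) _.
by rewrite -card_above_swap.
Qed.

Definition lost (x y : K) T T' := [&& rotation_edge T T', above x y T & ~~ above x y T'].

(** The rotation is determined by T: its lower vertex v is the child of x above
    y. *)
Lemma card_lost x y : inQ x -> inQ y ->
  (\sum_T #|[set T' | lost x y T T']| <= #|[set T | shortly_above x y T]|)%N.
Proof.
move=> xQ yQ; rewrite -[leqRHS]sum1dep_card [leqRHS]big_mkcond /=; apply: leq_sum => T _.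
have tT := searchTree_is_tree conK T.
have lostE T' : lost x y T T' -> exists v, [/\ T v = Some x, y \in subtree T v,
    parent T' = rotate T x v & shortly_above x y T].
  case/and3P; rewrite (rotation_edgeE conK) => /rotates_toP[u [v [Tv E]]].
  rewrite /above => /andP[-> yx] /=; rewrite E => nyx.
  have [ux yv ny] := rotate_lost tT Tv xQ yQ yx nyx.
  rewrite ux in Tv E; exists v; split=> //; first by rewrite -ux.
  by rewrite /shortly_above; case: ny => ->; rewrite eqxx ?orbT.
case: ifPn => [_|nn]; last first.
  rewrite leqn0 cards_eq0 -subset0; apply/subsetP => T'; rewrite inE.
  by case/lostE=> v [_ _ _]; rewrite (negbTE nn).
apply/card_le1_eqP => T1 T2; rewrite !inE.
case/lostE=> v1 [Tv1 yv1 E1 _] /lostE[v2 [Tv2 yv2 E2 _]].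
have wl a b : T a = Some x -> T b = Some x -> a \in subtree T b -> a = b.
  move=> Ta Tb /subtreeP[//|[e]]; rewrite Ta => -[<-].
  by rewrite (negbTE (parentN tT Tb)).
have vE : v1 = v2.
  case: (subtree_comparable yv1 yv2) => /wl; first exact.
  by move=> H; rewrite H.
by apply: val_inj; rewrite /= E1 E2 vE.
Qed.

End CompleteBipartite.

(** * The spectral gap *)

(** With N trees in all, x is above y in at least N/3 of them, so that the sum of
    the f(T)^2 is at least 2N/3. A change of f along an ordered pair of adjacent
    trees is at most 2, and is a loss of one of the two relations in one of the
    two directions; each relation is lost along at most 2N/(q-1) ordered
    pairs. *)
Lemma bipartite_gap (R : realType) p q : (0 < p)%N -> (1 < q)%N ->
  0 <= lambda1 R (rotation_graph (complete_bipartite p q))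
       - lambda2 R (rotation_graph (complete_bipartite p q)) <= 24 / q.-1%:R.
Proof.
move=> p_gt0 q_gt1; have q_gt0 := ltnW q_gt1.
pose K := complete_bipartite p q.
pose i := Ordinal q_gt0; pose j := Ordinal q_gt1.
pose x : K := inr i; pose y : K := inr j.
have ij : i != j by []; have xy : x != y by [].
have conK := connected_bipartite p_gt0 q_gt0.
pose N := #|{: searchTree K}|.
pose a := #|[set T | above x y T]|.
have aE : #|[set T | above y x T]| = a by rewrite /a (card_above_swap p_gt0 q_gt0).
pose f (T : rotation_graph K) : R := (above x y T)%:R - (above y x T)%:R.
have sum_above (b c : K) : \sum_T (above b c T)%:R = #|[set T | above b c T]|%:R :> R.
  rewrite -sum1dep_card natr_sum [RHS]big_mkcond; apply: eq_bigr => T _.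
  by case: above.
have f0 : \sum_T f T = 0 by rewrite sumrB !sum_above aE subrr.
have f2 : \sum_T f T ^+ 2 = (2 * a)%:R.
  rewrite mul2n -addnn natrD -{2}aE -!sum_above -big_split; apply: eq_bigr => T _.
  rewrite /f; have : ~~ (above x y T && above y x T).
    apply/negP => /andP[/andP[yx y_x] /andP[_ x_y]].
    by move: yx; rewrite (subtree_anti (searchTree_is_tree conK T) y_x x_y) eqxx.
  by case: (above x y T) => /=; case: (above y x T) => //= _; ring.
have aN : (N <= 3 * a)%N := card_incomparable p_gt0 q_gt0 ij.
have N0 : (0 < N)%N := searchTree_exists p_gt0 q_gt0.
have a0 : (0 < a)%N by rewrite lt0n; apply: contraTneq aN => ->; rewrite muln0 -ltnNge.
pose B := #|[set T | shortly_above x y T]|; pose B' := #|[set T | shortly_above y x T]|.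
have BN : (B * q.-1 <= 2 * N)%N := card_shortly_above p_gt0 q_gt0 ij.
have BN' : (B' * q.-1 <= 2 * N)%N by apply: card_shortly_above; rewrite // eq_sym.
apply: (regular_spectral_gap (f := f) (d := (#|K|).-1)) => //.
- by move=> T; apply: rotation_graph_regular.
- by rewrite f2 ltr0n muln_gt0.
- pose L (b c : K) (T T' : searchTree K) : R := (lost b c T T')%:R.
  have sumL (b c : K) : inQ b -> inQ c -> \sum_T \sum_T' L b c T T' <= (#|[set T | shortly_above b c T]|)%:R.
    move=> bQ cQ; have := card_lost p_gt0 q_gt0 bQ cQ; rewrite -(ler_nat R) natr_sum.
    apply: le_trans; rewrite le_eqVlt; apply/orP; left; apply/eqP.
    apply: eq_bigr => T _; rewrite -sum1dep_card natr_sum [RHS]big_mkcond.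
    by apply: eq_bigr => T' _; rewrite /L; case: lost.
  have pointwise (T T' : rotation_graph K) : (edge T T')%:R * (f T - f T') ^+ 2 <=
      4 * ((L x y T T' + L y x T T') + (L x y T' T + L y x T' T)).
    rewrite /L /lost /f /= [rotation_edge T' T]rotation_edge_sym.
    case: rotation_edge; rewrite /= ?mul0r; last lra.
    by do 4![case: above => /=]; lra.
  have H : \sum_T \sum_T' (edge T T')%:R * (f T - f T') ^+ 2 <= (8 * (B + B'))%:R.
    pose S := \sum_T \sum_T' L x y T T' + \sum_T \sum_T' L y x T T'.
    have SE : \sum_T \sum_T' (L x y T T' + L y x T T') = S.
      by rewrite /S -big_split; apply: eq_bigr => T _; rewrite -big_split.
    have SE' : \sum_T \sum_T' (L x y T' T + L y x T' T) = S by rewrite exchange_big SE.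
    apply: (@le_trans _ _ (4 * (S + S))).
      rewrite -{1}SE -SE' -big_split mulr_sumr; apply: ler_sum => T _.
      rewrite -big_split mulr_sumr; apply: ler_sum => T' _; exact: pointwise.
    have := lerD (sumL x y isT isT) (sumL y x isT isT).
    by rewrite -/S -/B -/B' natrM natrD; lra.
  have q1 : 0 < q.-1%:R :> R by rewrite ltr0n -ltnS prednK.
  apply: le_trans H _; rewrite f2 [_ / _ * _]mulrAC -mulrnAl ler_pdivlMr //.
  by rewrite -[leRHS]mulr_natr -!natrM ler_nat; lia.
Qed.

From mathcomp Require Import boolp classical_sets reals topology normedtype sequences.
Import Order.TTheory GRing.Theory Num.Theory.
Import numFieldNormedType.Exports.
Local Open Scope classical_set_scope.
Local Open Scope ring_scope.

Theorem mainTheorem7 (R : realType) (p : nat) (hp : (1 <= p)%N) :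
  (fun q : nat => lambda1 R (rotation_graph (complete_bipartite p q))
                  - lambda2 R (rotation_graph (complete_bipartite p q))) @ \oo --> (0 : R).
Proof.
apply: (@squeeze_cvgr _ _ _ _ (fun=> 0) (fun q => 24 / q.-1%:R)).
- near=> q; apply: bipartite_gap => //; near: q; exact: nbhs_infty_gt.
- exact: cvg_cst.
(* At q = n + 2 the bound is 24 times the harmonic sequence. *)
have : (fun n => 24 * harmonic n) @ \oo --> (0 : R).
  by rewrite -[X in _ --> X](mulr0 24); exact: cvgM (cvg_cst _) cvg_harmonic.
by move=> lim24; rewrite -cvg_shiftS -(cvg_shiftS (fun n => 24 / n%:R : R)); exact: lim24.
Unshelve. all: by end_near.
Qed.
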